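(* Let $A$ and $B$ be semisimple commutative Banach algebras with unit, and let $C$ be a semisimple Tomiyama product of $A$ and $B$. Suppose $C$ is a Ditkin algebra. Then $A$ and $B$ are Ditkin algebras.
   Context: Banach algebras are over $\mathbb{C}$. For commutative Banach algebras $A$ and $B$ with unit, a Tomiyama product of $A$ and $B$ is the completion of the algebraic tensor product $A\otimes B$ with respect to some submultiplicative cross norm (i.e. $\|a\otimes b\|=\|a\|\,\|b\|$) that is not less than the injective tensor product norm. For a commutative Banach algebra $D$ with unit, $M(D)$ is the set of nonzero multiplicative linear functionals $D\to\mathbb{C}$ with the relative weak-star topology from $D^*$, and $\hat a(\phi)=\phi(a)$. $D$ is semisimple if $a\mapsto\hat a$ is injective. The support $\mathrm{supp}(a)$ of $a\in D$ is the closure in $M(D)$ of $\{\phi\in M(D):\hat a(\phi)\ne0\}$. For $\phi\in M(D)$ put $I_\phi=\{a\in D:\hat a(\phi)=0\}$ and $J_\phi=\{a\in D:\phi\notin\mathrm{supp}(a)\}$. $D$ is a Ditkin algebra if for every $\phi\in M(D)$ and every $a\in I_\phi$, $a$ belongs to the norm closure of $aJ_\phi=\{ab:b\in J_\phi\}$. *)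

(* Defs.v *)
From HB Require Import structures.
From mathcomp Require Import all_boot all_order all_algebra sesquilinear.
From mathcomp Require Import all_classical all_reals all_analysis.
From mathcomp Require Import complex.

Set Implicit Arguments.
Unset Strict Implicit.
Unset Printing Implicit Defensive.

Import Order.TTheory GRing.Theory Num.Theory.
Import numFieldNormedType.Exports.

Local Open Scope classical_set_scope.
Local Open Scope ring_scope.

(* Commutative Banach algebra with unit 1 != 0; the norm of 1 is not required
   to be 1. This is a record over completeNormedModType rather than an HB join
   with comAlgType: HB refuses to join rings and normed modules, because
   numDomainType already inherits from both. The instances below give the
   carrier both structures. *)
Record comBanachAlg (K : numFieldType) := ComBanachAlg {
  banach_space : completeNormedModType K;
  banach_one : banach_space;
  banach_mul : banach_space -> banach_space -> banach_space;
  banach_mulA : associative banach_mul;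
  banach_mulC : commutative banach_mul;
  banach_mul1x : left_id banach_one banach_mul;
  banach_mulDl : left_distributive banach_mul +%R;
  banach_scaleAl : forall (k : K) x y,
    k *: banach_mul x y = banach_mul (k *: x) y;
  banach_one_neq0 : banach_one != 0;
  banach_normM : forall x y, `|banach_mul x y| <= `|x| * `|y|
}.

Definition banach_carrier (K : numFieldType) (D : comBanachAlg K) : Type :=
  banach_space D.
Coercion banach_carrier : comBanachAlg >-> Sortclass.

HB.instance Definition _ (K : numFieldType) (D : comBanachAlg K) :=
  CompleteNormedModule.copy (banach_carrier D) (banach_space D).
HB.instance Definition _ (K : numFieldType) (D : comBanachAlg K) :=
  GRing.Zmodule_isComNzRing.Build (banach_carrier D)
    (@banach_mulA _ D) (@banach_mulC _ D) (@banach_mul1x _ D)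
    (@banach_mulDl _ D) (@banach_one_neq0 _ D).
HB.instance Definition _ (K : numFieldType) (D : comBanachAlg K) :=
  GRing.Lmodule_isLalgebra.Build K (banach_carrier D) (@banach_scaleAl _ D).
HB.instance Definition _ (K : numFieldType) (D : comBanachAlg K) :=
  GRing.Lalgebra_isComAlgebra.Build K (banach_carrier D).

Section Tensor.
Variables (K : fieldType) (U V : lmodType K).

(* U (x) V is the space of those functions on the bilinear forms of U x V that
   are finite sums of evaluations beta |-> beta u v. Bilinear forms separate
   the elements of the algebraic tensor product over a field, so two formal
   sums of pure tensors have the same evaluation iff they are equal in it. *)
Definition bilinear_form := {bilinear U -> V -> K^o}.

Definition eval_sum (s : seq (U * V)) : bilinear_form -> K^o :=
  fun beta => \sum_(p <- s) beta p.1 p.2.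

Definition is_tensor : {pred bilinear_form -> K^o} :=
  fun t => `[< exists s, t = eval_sum s >].

Record tensor := Tensor {
  tensor_val :> bilinear_form -> K^o;
  _ : tensor_val \in is_tensor
}.

HB.instance Definition _ := [isSub for tensor_val].
HB.instance Definition _ := [Choice of tensor by <:].

Lemma is_tensorP t : reflect (exists s, t = eval_sum s) (t \in is_tensor).
Proof. exact: asboolP. Qed.

Lemma tensor_sumP (t : tensor) :
  exists s, t = eval_sum s :> (bilinear_form -> K^o).
Proof. by apply/is_tensorP; exact: valP. Qed.

Lemma tensor_inj (t t' : tensor) :
  t = t' :> (bilinear_form -> K^o) -> t = t'.
Proof. exact: val_inj. Qed.

Lemma is_tensor_submod : submod_closed is_tensor.
Proof.
split.
  by apply/is_tensorP; exists [::]; apply/funext => b; rewrite /eval_sum big_nil.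
move=> a _ _ /is_tensorP[s ->] /is_tensorP[s' ->]; apply/is_tensorP.
exists ([seq (a *: p.1, p.2) | p <- s] ++ s'); apply/funext => b.
rewrite /eval_sum big_cat big_map /= -[LHS]/(a *: _ + _) scaler_sumr.
by congr (_ + _); apply: eq_bigr => p _ /=; rewrite linearZl_LR.
Qed.

HB.instance Definition _ := GRing.isSubmodClosed.Build K _ is_tensor is_tensor_submod.
HB.instance Definition _ := [SubChoice_isSubLmodule of tensor by <:].

Lemma pure_tensor_subproof u v : eval_sum [:: (u, v)] \in is_tensor.
Proof. by apply/is_tensorP; exists [:: (u, v)]. Qed.

Definition pure_tensor (u : U) (v : V) : tensor :=
  Tensor (pure_tensor_subproof u v).
End Tensor.

Arguments is_tensor {K U V}.

Section TensorAlgebra.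
Variables (K : fieldType) (A B : comAlgType K).
Local Notation form := (bilinear_form A B).
Local Notation tensor := (tensor A B).

Section Shift.
Variables (beta : form) (a : A) (b : B).

Definition shift_form (x : A) (y : B) : K^o := beta (a * x) (b * y).

Lemma shift_form_bilinear : bilinear_for *:%R *:%R shift_form.
Proof.
by split=> [y k x x'|x k y y']; rewrite /shift_form mulrDr -scalerAr
  ?linearPl ?linearPr.
Qed.

HB.instance Definition _ :=
  bilinear_isBilinear.Build K A B K^o *:%R *:%R shift_form shift_form_bilinear.
End Shift.

Section Contract.
Variables (t : tensor) (beta : form).

Definition contract_form (a : A) (b : B) : K^o := t (shift_form beta a b).

Lemma contract_form_bilinear : bilinear_for *:%R *:%R contract_form.
Proof.
rewrite /contract_form; case: t => t0 /= /is_tensorP[s ->].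
split=> [b k a a'|a k b b'] /=; rewrite /eval_sum scaler_sumr -big_split /=;
  apply: eq_bigr => p _; rewrite /shift_form mulrDl -scalerAl ?linearPl //.
by rewrite linearPr.
Qed.

HB.instance Definition _ := bilinear_isBilinear.Build K A B K^o *:%R *:%R
  contract_form contract_form_bilinear.
End Contract.

(* (a (x) b) * (a' (x) b') = (a * a') (x) (b * b'), extended bilinearly: t' is
   applied to (a', b') |-> beta (a * a') (b * b'), then t to the result as a
   form in (a, b). See mul_tensor_sum. *)
Definition mul_fun (t t' : tensor) : form -> K^o :=
  fun beta => t (contract_form t' beta).

Lemma mul_fun_sum (t t' : tensor) s s' :
  t = eval_sum s :> (form -> K^o) -> t' = eval_sum s' :> (form -> K^o) ->
  mul_fun t t' =
    eval_sum [seq (p.1 * p'.1, p.2 * p'.2) | p <- s, p' <- s'].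
Proof.
move=> ts ts'; apply/funext => beta.
by rewrite /mul_fun ts /eval_sum big_allpairs_dep /=; apply: eq_bigr => p _;
  rewrite /contract_form ts'.
Qed.

Lemma mul_tensor_subproof t t' : mul_fun t t' \in is_tensor.
Proof.
have [s ts] := tensor_sumP t; have [s' ts'] := tensor_sumP t'.
by apply/is_tensorP; eexists; exact: mul_fun_sum ts ts'.
Qed.

Definition one_tensor : tensor := pure_tensor 1 1.
Definition mul_tensor (t t' : tensor) : tensor :=
  Tensor (mul_tensor_subproof t t').

Lemma mul_tensor_sum (t t' : tensor) s s' :
  t = eval_sum s :> (form -> K^o) -> t' = eval_sum s' :> (form -> K^o) ->
  mul_tensor t t' =
    eval_sum [seq (p.1 * p'.1, p.2 * p'.2) | p <- s, p' <- s']
    :> (form -> K^o).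
Proof. exact: mul_fun_sum. Qed.

Lemma mul_tensorC : commutative mul_tensor.
Proof.
move=> t t'; have [s ts] := tensor_sumP t; have [s' ts'] := tensor_sumP t'.
apply: tensor_inj; rewrite (mul_tensor_sum ts ts') (mul_tensor_sum ts' ts).
apply/funext => beta; rewrite /eval_sum !big_allpairs_dep /= exchange_big /=.
by apply: eq_bigr => p _; apply: eq_bigr => q _; rewrite mulrC [X in beta _ X]mulrC.
Qed.

Lemma mul_tensorA : associative mul_tensor.
Proof.
move=> t t' t''; have [s ts] := tensor_sumP t.
have [s' ts'] := tensor_sumP t'; have [s'' ts''] := tensor_sumP t''.
apply: tensor_inj; rewrite (mul_tensor_sum ts (mul_tensor_sum ts' ts'')).
rewrite (mul_tensor_sum (mul_tensor_sum ts ts') ts'').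
apply/funext => beta; rewrite /eval_sum !big_allpairs_dep /=.
apply: eq_bigr => p _; rewrite !big_allpairs_dep /=.
by apply: eq_bigr => q _; apply: eq_bigr => r _; rewrite !mulrA.
Qed.

Lemma mul1_tensor : left_id one_tensor mul_tensor.
Proof.
move=> t; have [s ts] := tensor_sumP t; apply: tensor_inj.
rewrite (@mul_tensor_sum one_tensor t [:: (1, 1)] s erefl ts).
rewrite ts; apply/funext => beta; rewrite /eval_sum big_allpairs_dep /=.
by rewrite big_seq1; apply: eq_bigr => p _; rewrite !mul1r.
Qed.

Lemma mul_tensorDl : left_distributive mul_tensor +%R.
Proof. by move=> t t' t''; apply: tensor_inj. Qed.

HB.instance Definition _ := GRing.Zmodule_isComPzRing.Build tensor
  mul_tensorA mul_tensorC mul1_tensor mul_tensorDl.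

End TensorAlgebra.

Section Banach.
Variable R : realType.

(* Norms over R[i] take their values in the nonnegative reals of R[i]. *)
Definition rnorm (V : normedModType R[i]) (x : V) : R := complex.Re `|x|.

Section Spectrum.
Variable D : comBanachAlg R[i].

(* Weak-star convergence in D^* is pointwise convergence, and characters of a
   Banach algebra are bounded, so the relative weak-star topology on M(D) is
   the one that the type of elements of this set inherits from the functions
   D -> R[i] with the topology of pointwise convergence. *)
Definition characters : set {ptws D -> R[i]^o} :=
  [set phi | [/\ scalar phi, {morph phi : x y / x * y} & exists a, phi a != 0]].

Definition gelfand (a : D) (phi : characters) : R[i] := set_val phi a.

Definition semisimple : Prop := injective gelfand.

Definition supp (a : D) : set characters :=
  closure [set phi | gelfand a phi != 0].

Definition I_at (phi : characters) : set D := [set a | gelfand a phi = 0].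

Definition J_at (phi : characters) : set D := [set a | ~ supp a phi].

Definition Ditkin : Prop :=
  forall (phi : characters) (a : D), I_at phi a ->
    closure [set a * b | b in J_at phi] a.

(* Closed unit ball of D^* for the operator norm. *)
Definition dual_ball : set {linear D -> R[i]^o} :=
  [set f | forall x, `|f x| <= `|x|].
End Spectrum.

Arguments characters D : clear implicits.
Arguments dual_ball D : clear implicits.

Section Product.
Variables A B : comBanachAlg R[i].

Section ProductForm.
Variables (f : {linear A -> R[i]^o}) (g : {linear B -> R[i]^o}).

Definition prod_form (a : A) (b : B) : R[i]^o := f a * g b.

Lemma prod_form_bilinear : bilinear_for *:%R *:%R prod_form.
Proof.
split=> [b k a a'|a k b b']; rewrite /prod_form linearP.
  by rewrite mulrDl -scalerAl.
by rewrite mulrDr -scalerAr.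
Qed.

HB.instance Definition _ := bilinear_isBilinear.Build R[i] A B R[i]^o
  *:%R *:%R prod_form prod_form_bilinear.
End ProductForm.

(* The set is nonempty (f = g = 0) and bounded, by the sum of the |a_i| |b_i|
   for any representation t = sum of a_i (x) b_i, so sup is a true supremum. *)
Definition injective_norm (t : tensor A B) : R :=
  sup [set rnorm (t (prod_form f g)) | f in dual_ball A & g in dual_ball B].

Record Tomiyama_norm (N : tensor A B -> R) : Prop := {
  Tomiyama_normD : forall t u, N (t + u) <= N t + N u;
  Tomiyama_normZ : forall (k : R[i]^o) t, N (k *: t) = rnorm k * N t;
  Tomiyama_norm0 : forall t, N t = 0 -> t = 0;
  Tomiyama_normM : forall t u, N (t * u) <= N t * N u;
  Tomiyama_cross : forall a b, N (pure_tensor a b) = rnorm a * rnorm b;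
  Tomiyama_ge_injective : forall t, injective_norm t <= N t
}.

(* C is complete by its type, so an isometric homomorphism with dense range
   makes C the completion of the normed algebra (A (x) B, N), which is unique
   up to isometric isomorphism. *)
Record is_completion (N : tensor A B -> R) (C : comBanachAlg R[i])
    (iota : tensor A B -> C) : Prop := {
  completion_linear : linear iota;
  completion_morph : monoid_morphism iota;
  completion_isometry : forall t, rnorm (iota t) = N t;
  completion_dense : dense (range iota)
}.

Definition Tomiyama_product (C : comBanachAlg R[i]) : Prop :=
  exists (N : tensor A B -> R) (iota : tensor A B -> C),
    Tomiyama_norm N /\ is_completion N iota.
End Product.
End Banach.

Arguments characters {R} D.
Arguments dual_ball {R} D.

(* Main.v *)
From HB Require Import structures.
Require Import Defs.
From mathcomp Require Import all_boot all_order all_algebra.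
From mathcomp Require Import all_classical all_reals all_analysis.
From mathcomp Require Import complex.
From mathcomp Require Import sesquilinear lra ring.

(** The Ditkin property passes from [C] to [D] along a contractive algebra
    homomorphism [T] of [C] onto [D]: [phi |-> phi \o T] is weak-star continuous
    from [M(D)] to [M(C)], so [T] maps [J_(phi \o T)] into [J_phi], and applying
    [T] to [c b ~ c] gives [T c * T b ~ T c]. Semisimplicity provides a
    character [psi] of [B], and [T] is the slice map [id (x) psi : C -> A].
    It is contractive on the algebraic tensor product because, for a norming
    functional [f] of [A], [f (T t) = t (f (x) psi)] is bounded by the injective
    norm of [t], and it extends to [C] by density. The case of [B] is symmetric. *)

Set Implicit Arguments.
Unset Strict Implicit.
Unset Printing Implicit Defensive.

Import Order.TTheory GRing.Theory Num.Theory.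
Import numFieldNormedType.Exports.

Local Open Scope complex_scope.
Local Open Scope classical_set_scope.
Local Open Scope ring_scope.

(** * The Hahn-Banach theorem for seminorms and complex normed spaces *)

Section HahnBanach.
Variables (R : realType) (V : lmodType R) (p : V -> R).
Hypothesis pD : forall u v, p (u + v) <= p u + p v.
Hypothesis pZ : forall a v, p (a *: v) = `|a| * p v.

(* The last clause is vacuous for the empty graph: Zorn's lemma also asks for
   the union of the empty chain. *)
Definition dominated_graph (x : V) (F : set (V * R)) : Prop :=
  [/\ forall a z z', F z -> F z' -> F (a *: z.1 + z'.1, a * z.2 + z'.2),
      forall z, F z -> z.2 <= p z.1 & F !=set0 -> F (x, p x)].

Lemma seminorm0 : p 0 = 0.
Proof. by rewrite -(scale0r (0 : V)) pZ normr0 mul0r. Qed.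

(** By linearity [F] contains [(0, r' - r)] and [(0, r - r')], and both second components are at
    most [p 0 = 0]. *)
Lemma dominated_graph_fun x F v r r' :
  dominated_graph x F -> F (v, r) -> F (v, r') -> r = r'.
Proof.
move=> [linF leF _] Fr Fr'.
have := leF _ (linF (-1) _ _ Fr Fr'); have := leF _ (linF (-1) _ _ Fr' Fr).
by rewrite /= scaleN1r addNr seminorm0; lra.
Qed.

Lemma dominated_graph_line x :
  dominated_graph x [set (a *: x, a * p x) | a in [set: R]].
Proof.
split.
- move=> a _ _ [b _ <-] [c _ <-] /=; exists (a * b + c) => //.
  by rewrite scalerDl scalerA mulrDl mulrA.
- move=> _ [a _ <-] /=; rewrite pZ ler_wpM2r ?ler_norm //.
  (* What remains is [0 <= p x], which comes from [0 = p (x - x) <= p x + p x]. *)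
  have := pD x (- x); rewrite subrr seminorm0 -scaleN1r pZ normrN1; lra.
- by move=> _; exists 1; rewrite // scale1r mul1r.
Qed.

(** The chain condition for Zorn's lemma: any two points of the union already lie in a common
    member. *)
Lemma dominated_graph_bigcup x (Fs : set (set (V * R))) :
  Fs `<=` dominated_graph x -> total_on Fs subset ->
  dominated_graph x (\bigcup_(F in Fs) F).
Proof.
move=> domF totF; split.
- move=> a z z' [F FsF Fz] [G FsG Gz'].
  have [FG|GF] := totF F G FsF FsG.
    by exists G => //; have [linG _ _] := domF _ FsG; apply: linG => //; apply: FG.
  by exists F => //; have [linF _ _] := domF _ FsF; apply: linF => //; apply: GF.
- by move=> z [F /domF[_ leF _] /leF].
- by move=> [z [F FsF Fz]]; exists F => //; have [_ _] := domF _ FsF; apply; exists z.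
Qed.

(** The value [c] to be given to [v]. Subadditivity of [p] puts each lower bound below each upper
    bound, so the supremum of the lower bounds fits. *)
Lemma dominated_graph_extension_value x F v :
  dominated_graph x F -> F !=set0 ->
  exists c, forall z, F z -> z.2 - p (z.1 - v) <= c <= p (z.1 + v) - z.2.
Proof.
move=> [linF leF _] [z0 Fz0].
have key z z' : F z -> F z' -> z.2 - p (z.1 - v) <= p (z'.1 + v) - z'.2.
  move=> Fz Fz'; have := leF _ (linF 1 _ _ Fz Fz'); rewrite /= scale1r mul1r.
  by have := pD (z.1 - v) (z'.1 + v); rewrite addrACA addNr addr0; lra.
have supF : has_sup [set z.2 - p (z.1 - v) | z in F].
  split; first by exists (z0.2 - p (z0.1 - v)), z0.
  by exists (p (z0.1 + v) - z0.2) => _ [z Fz <-]; exact: key.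
exists (sup [set z.2 - p (z.1 - v) | z in F]) => z Fz; apply/andP; split.
  by apply: sup_upper_bound => //; exists z.
by apply: sup_le_ub => [|_ [z' Fz' <-]]; [case: supF | exact: key].
Qed.

Lemma dominated_graph_extend x F v : dominated_graph x F -> F !=set0 ->
  exists c G, [/\ dominated_graph x G, F `<=` G & G (v, c)].
Proof.
move=> domF F0; have [c cP] := dominated_graph_extension_value v domF F0.
have [linF leF Fx] := domF.
have F00 : F (0, 0).
  have [z Fz] := F0; have := linF (-1) _ _ Fz Fz.
  by rewrite scaleN1r mulN1r !addNr.
have FZ a z : F z -> F (a *: z.1, a * z.2).
  by move=> Fz; have := linF a _ _ Fz F00; rewrite /= !addr0.
(* The extension is the sum of [F] and the line spanned by [(v, c)]. *)
exists c, [set z | exists t z', F z' /\ z = (z'.1 + t *: v, z'.2 + t * c)].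
split; last 1 first.
- by exists 1, (0, 0); rewrite /= scale1r mul1r !add0r.
- split.
  + move=> a _ _ [t [z [Fz ->]]] [t' [z' [Fz' ->]]] /=.
    exists (a * t + t'), (a *: z.1 + z'.1, a * z.2 + z'.2); split; first exact: linF.
    congr pair; last by rewrite /=; ring.
    by rewrite scalerDr scalerA scalerDl /= addrACA.
  (* For nonzero [t], dividing by its absolute value reduces domination to the upper bound on [c] if
     [t > 0] and to the lower bound if [t < 0]. *)
  + move=> _ [t [z [Fz ->]]] /=; have [t0|t0|->] := ltgtP t 0; last first.
    * by rewrite scale0r mul0r !addr0; exact: leF.
    * have /cP/andP[_] := FZ t^-1 _ Fz; rewrite -(ler_pM2l t0) /=.
      have := pZ t (t^-1 *: z.1 + v); rewrite gtr0_norm // scalerDr scalerA.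
      by rewrite mulfV ?gt_eqF // scale1r mulrBr mulrA mulfV ?gt_eqF // mul1r; lra.
    * have Nt0 : 0 < - t by rewrite oppr_gt0.
      have /cP/andP[+ _] := FZ (- t)^-1 _ Fz; rewrite -(ler_pM2l Nt0) /=.
      have := pZ (- t) ((- t)^-1 *: z.1 - v); rewrite gtr0_norm // scalerBr scalerA.
      rewrite scaleNr opprK mulfV ?gt_eqF // scale1r mulrBr mulrA mulfV ?gt_eqF //.
      by rewrite mul1r; lra.
  + move=> _; exists 0, (x, p x); split; first exact: Fx.
    by rewrite scale0r mul0r !addr0.
- move=> [u r] Fu; exists 0, (u, r); split => //.
  by rewrite scale0r mul0r !addr0.
Qed.

Theorem Hahn_Banach_seminorm (x : V) : exists f : V -> R,
  [/\ scalar f, forall v, f v <= p v & f x = p x].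
Proof.
have [F [domF maxF]] := Zorn_bigcup (@dominated_graph_bigcup x).
have F0 : F !=set0.
  (* The empty graph is not maximal, since the graph over the line through [x] strictly contains
     it. *)
  apply/set0P/negP => /eqP F0.
  apply: maxF (dominated_graph_line x); rewrite F0 properEneq; split => //.
  by rewrite eq_sym; apply/set0P; exists (0 *: x, 0 * p x), 0.
have totF v : exists c, F (v, c).
  have [c [G [domG FG Gc]]] := dominated_graph_extend v domF F0.
  exists c; have [-> //|FneG] := eqVneq F G.
  by case: (maxF G) => //; rewrite properEneq.
have [f Ff] := choice totF; have [linF leF Fx] := domF.
exists f; split.
- move=> a u v; apply: dominated_graph_fun domF (Ff _) _.
  exact: linF (Ff u) (Ff v).
- by move=> v; exact: leF (Ff v).
- exact: dominated_graph_fun domF (Ff x) (Fx F0).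
Qed.

End HahnBanach.

(** * Real-valued norms on complex normed spaces *)

Section RealNorm.
Variables (R : realType) (V : normedModType R[i]).
Implicit Types x y : V.

Lemma rnormE x : `|x| = (rnorm x)%:C.
Proof. by rewrite /rnorm RRe_real // normr_real. Qed.

Lemma rnorm_ge0 x : 0 <= rnorm x.
Proof. by rewrite -ler0c -rnormE. Qed.

Lemma rnormD x y : rnorm (x + y) <= rnorm x + rnorm y.
Proof. by rewrite -lecR rmorphD /= -!rnormE ler_normD. Qed.

Lemma rnormN x : rnorm (- x) = rnorm x.
Proof. by rewrite /rnorm normrN. Qed.

Lemma rnorm_dist x y : rnorm (x - y) = rnorm (y - x).
Proof. by rewrite -rnormN opprB. Qed.

Lemma rnorm0 : rnorm (0 : V) = 0.
Proof. by rewrite /rnorm normr0. Qed.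

Lemma rnorm0_eq0 x : rnorm x = 0 -> x = 0.
Proof. by move=> x0; apply: normr0_eq0; rewrite rnormE x0. Qed.

Lemma rnorm_sum I (s : seq I) (F : I -> V) :
  rnorm (\sum_(i <- s) F i) <= \sum_(i <- s) rnorm (F i).
Proof.
elim/big_rec2: _ => [|i b a _ ab]; first by rewrite rnorm0.
by apply: le_trans (rnormD _ _) _; rewrite lerD2l.
Qed.

Lemma rnormZ (k : R[i]^o) x : rnorm (k *: x) = rnorm k * rnorm x.
Proof. by apply: complexI; rewrite rmorphM /= -!rnormE normrZ. Qed.

Lemma rnormZr (a : R) x : rnorm (a%:C *: x) = `|a| * rnorm x.
Proof.
by rewrite rnormZ {1}/rnorm normc_def /= expr0n addr0 sqrtr_sqr.
Qed.

End RealNorm.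

Lemma ler_rnorm (R : realType) (V W : normedModType R[i]) (x : V) (y : W) :
  (`|x| <= `|y|) = (rnorm x <= rnorm y).
Proof. by rewrite !rnormE lecR. Qed.

Lemma rnormM (R : realType) (D : comBanachAlg R[i]) (x y : D) :
  rnorm (x * y) <= rnorm x * rnorm y.
Proof. by rewrite -lecR rmorphM /= -!rnormE; exact: banach_normM. Qed.

Lemma rnormcM (R : realType) (k l : R[i]^o) : rnorm (k * l : R[i]^o) = rnorm k * rnorm l.
Proof. exact: rnormZ. Qed.

(** Restriction of scalars: a separate name for the carrier, so that it can bear a module structure
    over [R] and the real Hahn-Banach theorem applies. *)
Definition realified (R : realType) (V : lmodType R[i]) : Type := V.

Section Realified.
Variables (R : realType) (V : lmodType R[i]).

HB.instance Definition _ := GRing.Zmodule.on (realified V).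

Definition realified_scale (a : R) (v : realified V) : realified V := a%:C *: (v : V).

Lemma realified_scaleA a b v :
  realified_scale a (realified_scale b v) = realified_scale (a * b) v.
Proof. by rewrite /realified_scale scalerA -rmorphM. Qed.

Lemma realified_scale1 : left_id 1 realified_scale.
Proof. by move=> v; rewrite /realified_scale scale1r. Qed.

Lemma realified_scaleDr : right_distributive realified_scale +%R.
Proof. by move=> a u v; rewrite /realified_scale scalerDr. Qed.

Lemma realified_scaleDl v : {morph realified_scale^~ v : a b / a + b}.
Proof. by move=> a b; rewrite /realified_scale rmorphD scalerDl. Qed.

HB.instance Definition _ := GRing.Zmodule_isLmodule.Build R (realified V)
  realified_scaleA realified_scale1 realified_scaleDr realified_scaleDl.

End Realified.

(** * Norming functionals over the complex numbers *)

Section ComplexHahnBanach.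
Variables (R : realType) (V : normedModType R[i]).

Theorem Hahn_Banach_norming (x : V) : exists f : {linear V -> R[i]^o},
  (forall v, rnorm (f v) <= rnorm v) /\ rnorm x <= rnorm (f x).
Proof.
have [f [lin_f f_le fx]] := @Hahn_Banach_seminorm R (realified V) (@rnorm R V)
  (@rnormD _ _) (@rnormZr _ _) x.
have fD u v : f ((u : V) + v) = f u + f v.
  by have := lin_f 1 u v; rewrite scale1r mul1r.
have f0 : f (0 : V) = 0 by have := fD 0 0; rewrite addr0; lra.
have fZ (a : R) (v : V) : f (a%:C *: v) = a * f v.
  by have := lin_f a v 0; rewrite addr0 f0 addr0.
(* The only complex-linear functional with real part [f]: its imaginary part at [v] must be minus
   its real part at ['i *: v]. *)
pose g (v : V) : R[i]^o := Complex (f v) (- f ('i *: v)).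
have lin_g : scalar g.
  move=> k u v; rewrite /g.
  have fk (w : V) : f (k *: w) = complex.Re k * f w + complex.Im k * f ('i *: w).
    by rewrite {1}[k]complexE scalerDl fD mulrC -!scalerA !fZ.
  rewrite scalerDr !fD scalerA ['i * k]mulrC -scalerA !fk scalerA.
  have -> : 'i * 'i = -1 :> R[i] by rewrite -expr2 sqr_i.
  rewrite scaleN1r.
  have -> : f (- u) = - f u by have := fD (- u) u; rewrite addNr f0; lra.
  case: k {fk} => a b; rewrite /=; apply/eqP; rewrite eq_complex /=.
  by apply/andP; split; apply/eqP; ring.
pose G : {linear V -> R[i]^o} := HB.pack g (GRing.isLinear.Build _ _ _ _ g lin_g).
have Re_le (z : R[i]^o) : complex.Re z <= rnorm z.
  rewrite -lecR -rnormE normc_def lecR.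
  by apply: le_trans (ler_norm _) _; rewrite -sqrtr_sqr ler_wsqrtr // lerDl sqr_ge0.
exists G; split; last by rewrite -fx; exact: Re_le (G x).
move=> v; have [gv0|gv0] := eqVneq (rnorm (G v)) 0.
  by rewrite gv0 rnorm_ge0.
have gv : `|G v| != 0 :> R[i]^o by rewrite rnormE; apply: contra gv0 => /eqP [->].
(* This unimodular factor rotates [G v] onto the positive real axis, where the modulus equals the
   real part [f (u *: v)]. *)
pose u : R[i]^o := `|G v| / G v.
have u1 : rnorm u = 1.
  apply: complexI; rewrite -rnormE /u normf_div normr_id divff //.
have -> : rnorm (G v) = complex.Re (G (u *: v)).
  have -> : G (u *: v) = u * G v by exact: linearZZ.
  by rewrite mulfVK; [rewrite rnormE | rewrite -normr_eq0].
by apply: le_trans (f_le _) _; rewrite rnormZ u1 mul1r.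
Qed.

End ComplexHahnBanach.

(** * Completeness and characters *)

Lemma ball_rnorm (R : realType) (V : normedModType R[i]) (x y : V) (e : R) :
  ball x e%:C y <-> rnorm (x - y) < e.
Proof. by rewrite -ball_normE /= rnormE ltcR. Qed.

Lemma gt0_complex (R : realType) (e : R[i]) : 0 < e -> exists2 d : R, 0 < d & e = d%:C.
Proof. by case: e => a b; rewrite ltcE /= => /andP[/eqP -> a0]; exists a. Qed.

Lemma nbhs_rnorm (R : realType) (V : normedModType R[i]) (x : V) (U : set V) :
  nbhs x U <-> exists2 e : R, 0 < e & forall y, rnorm (x - y) < e -> U y.
Proof.
rewrite nbhs_ballP; split=> [[e /= e0 xU]|[e e0 xU]].
  have [d d0 ed] := gt0_complex e0; exists d => // y xy.
  by apply: xU; rewrite ed; apply/ball_rnorm.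
by exists e%:C; rewrite /= ?ltcR // => y /ball_rnorm; exact: xU.
Qed.

(** Completeness with a rate: the Cauchy bound [q] survives in the limit and controls the distance
    to it. *)
Lemma complete_rnorm (R : realType) (V : completeNormedModType R[i])
    (u : nat -> V) (q : nat -> R) :
  (forall e, 0 < e -> exists n, q n < e) ->
  (forall m n, (m <= n)%N -> rnorm (u n - u m) <= q m) ->
  exists l, forall n, rnorm (l - u n) <= q n.
Proof.
move=> q0 uq; have : cvg (u @ \oo).
  apply/cauchy_cvgP/cauchyP => e /gt0_complex[d d0 ->].
  have [N qN] := q0 _ d0; exists (u N), N => // n /= Nn.
  by apply/ball_rnorm; rewrite rnorm_dist (le_lt_trans (uq _ _ Nn)).
move=> /cvg_ex[l ul]; exists l => n; apply/ler_addgt0Pr => e e0.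
have [N _ Nu] : \forall k \near \oo, rnorm (l - u k) < e.
  by apply: (ul [set y | rnorm (l - y) < e]); apply/nbhs_rnorm; exists e.
have := Nu (maxn N n) (leq_maxl _ _); have := uq _ _ (leq_maxr N n).
have := rnormD (l - u (maxn N n)) (u (maxn N n) - u n).
rewrite addrA subrK /=; lra.
Qed.

(** The inverse is the Neumann series, the limit of the partial sums [u n]. The norm of [1] enters
    the estimates because it may differ from 1. *)
Lemma one_sub_unit (R : realType) (D : comBanachAlg R[i]) (y : D) :
  rnorm y < 1 -> exists z : D, (1 - y) * z = 1.
Proof.
move=> y1; set r := rnorm y; have r0 : 0 <= r := rnorm_ge0 y.
have rnormX n : rnorm (y ^+ n) <= rnorm (1 : D) * r ^+ n.
  elim: n => [|n IHn]; first by rewrite !expr0 mulr1.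
  rewrite !exprS; apply: le_trans (rnormM _ _) _.
  by rewrite mulrCA ler_wpM2l.
have small (C e : R) : 0 < e -> exists n, C * r ^+ n < e.
  move=> e0; have : (C * r ^+ n) @[n --> \oo] --> (0 : R).
    rewrite -[X in _ --> X](mulr0 C); apply: cvgMr.
    by apply: cvg_expr; rewrite ger0_norm.
  move=> /cvgrPdist_lt/(_ e e0)[N _ /(_ N (leqnn N))].
  by rewrite /= sub0r normrN => /(le_lt_trans (ler_norm _)); exists N.
pose u n : D := \sum_(k < n) y ^+ k.
have uE n : (1 - y) * u n = 1 - y ^+ n.
  by rewrite -opprB -(opprB (y ^+ n)) mulNr -subrX1.
(* [C * r ^+ n] is the tail from [n] on of the geometric series with terms [rnorm 1 * r ^+ k]. *)
pose C := rnorm (1 : D) / (1 - r).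
have C_ge0 : 0 <= C by rewrite divr_ge0 ?rnorm_ge0 // subr_ge0 ltW.
have [|m n mn|z zu] := @complete_rnorm _ (banach_space D) u (fun n => C * r ^+ n).
- exact: small.
(* The exact geometric sum, rather than the whole tail, is what induction on [n - m] can carry. *)
- suff : rnorm (u n - u m) <= C * (r ^+ m - r ^+ n).
    by have := mulr_ge0 C_ge0 (exprn_ge0 n r0); rewrite mulrBr; lra.
  have C1 : rnorm (1 : D) = C * (1 - r) by rewrite mulfVK // subr_eq0 gt_eqF.
  rewrite -(subnK mn); elim: (n - m)%N => [|k IHk].
    by rewrite !subrr rnorm0 mulr0.
  rewrite addSn /u big_ord_recr /= -/(u _) addrAC.
  apply: le_trans (rnormD _ _) _; have := rnormX (k + m)%N; rewrite C1 exprS.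
  by move: IHk; rewrite !mulrBr; lra.
exists z; apply/eqP; rewrite -subr_eq0; apply/eqP/rnorm0_eq0.
apply/eqP; rewrite eq_le rnorm_ge0 andbT; apply/ler_addgt0Pr => e e0.
have [n Cn] := small (rnorm (1 - y) * C + rnorm (1 : D)) e e0.
rewrite add0r; apply: le_trans (ltW Cn).
have -> : (1 - y) * z - 1 = (1 - y) * (z - u n) - y ^+ n.
  by rewrite mulrBr uE; ring.
apply: le_trans (rnormD _ _) _; rewrite rnormN [leRHS]mulrDl lerD //.
apply: le_trans (rnormM _ _) _; rewrite -mulrA.
by apply: ler_wpM2l; [exact: rnorm_ge0 | exact: zu].
Qed.

Definition character_linear (R : realType) (D : comBanachAlg R[i]) (phi : D -> R[i]^o)
  (phiP : characters D phi) : {linear D -> R[i]^o} :=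
  let: And3 lin_phi _ _ := phiP in
  HB.pack phi (GRing.isLinear.Build _ _ _ _ phi lin_phi).

Lemma character_linearE (R : realType) (D : comBanachAlg R[i]) (phi : D -> R[i]^o)
  (phiP : characters D phi) : character_linear phiP = phi :> (D -> R[i]^o).
Proof. by rewrite /character_linear; case: phiP. Qed.

Lemma character1 (R : realType) (D : comBanachAlg R[i]) (phi : D -> R[i]^o) :
  characters D phi -> phi 1 = 1.
Proof.
move=> [_ phiM [a phia]].
by have := phiM 1 a; rewrite mul1r => /esym/(canRL (mulfK phia)); rewrite mulfV.
Qed.

(** If [phi x] exceeded the norm of [x], then [x / phi x] would have norm below 1, so
    [1 - x / phi x] would be invertible although [phi] kills it. *)
Lemma character_le_rnorm (R : realType) (D : comBanachAlg R[i]) (phi : D -> R[i]^o) :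
  characters D phi -> forall x : D, rnorm (phi x) <= rnorm x.
Proof.
move=> phiP x; rewrite leNgt; apply/negP => x_lt.
have phix0 : phi x != 0.
  apply: contraTneq x_lt => ->; rewrite rnorm0 -leNgt; exact: rnorm_ge0.
have [|z] := @one_sub_unit _ D ((phi x)^-1 *: x).
  rewrite rnormZ; have phix_gt0 : 0 < rnorm (phi x).
    exact: le_lt_trans (rnorm_ge0 x) x_lt.
  have inv : rnorm ((phi x)^-1 : R[i]^o) * rnorm (phi x) = 1.
    by rewrite -rnormcM mulVf // /rnorm normr1.
  rewrite -inv ltr_pM2l // -(pmulr_lgt0 _ phix_gt0) inv; exact: ltr01.
have [_ phiM _] := phiP; move=> /(congr1 phi); rewrite phiM (character1 phiP).
have -> : phi (1 - (phi x)^-1 *: x) = 0.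
  rewrite -(character_linearE phiP) linearB linearZ /= character_linearE.
  by rewrite (character1 phiP) -[_ *: _]/(_ * _) mulVf // subrr.
by rewrite mul0r => /esym/eqP; rewrite oner_eq0.
Qed.

(** Without characters all Gelfand transforms coincide, and injectivity would force [1 = 0]. *)
Lemma semisimple_character (R : realType) (D : comBanachAlg R[i]) :
  semisimple D -> characters D !=set0.
Proof.
move=> ssD; apply: contrapT => noD; have : (1 : D) = 0.
  apply: ssD; apply/funext => phi.
  by case: noD; exists (set_val phi); exact: set_valP.
by apply/eqP; exact: oner_neq0.
Qed.

(** * Ditkin algebras and quotients *)

Section DitkinImage.
Variables (R : realType) (C D : comBanachAlg R[i]) (T : C -> D).
Hypotheses (linT : linear T) (TM : {morph T : x y / x * y}).
Hypotheses (T_le : forall c, rnorm (T c) <= rnorm c).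
Hypothesis surjT : forall d, exists c, T c = d.

Lemma character_pullback (phi : D -> R[i]^o) :
  characters D phi -> characters C (phi \o T).
Proof.
move=> [lin_phi phiM [d phid]]; split.
- by move=> k x y; rewrite /= linT lin_phi.
- by move=> x y; rewrite /= TM phiM.
- by have [c Tc] := surjT d; exists c; rewrite /= Tc.
Qed.

Definition pullback (phi : characters D) : characters C :=
  SigSub (mem_set (character_pullback (set_valP phi))).

(** The topology of [M(C)] is initial for the evaluations, and evaluating [phi \o T] at [c] is
    evaluating [phi] at [T c]. *)
Lemma pullback_continuous : continuous pullback.
Proof.
apply: continuous_comp_initial.
move=> phi.
apply/(@pointwise_cvgP C R[i]^o _ _ (fmap_filter _ (nbhs_filter phi))) => c.
have cval : continuous (set_val : characters D -> {ptws D -> R[i]^o}).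
  exact: (@initial_continuous (characters D) {ptws D -> R[i]^o} set_val).
have cproj : continuous (proj (T c) : {ptws D -> R[i]^o} -> R[i]^o).
  exact: proj_continuous.
have := continuous_comp (cval phi) (cproj _).
exact.
Qed.

(** The transform of [c] at [pullback chi] is that of [T c] at [chi]. Read contrapositively, [T]
    sends [J_at (pullback phi)] into [J_at phi]. *)
Lemma supp_pullback (phi : characters D) (c : C) :
  supp (T c) phi -> supp c (pullback phi).
Proof.
move=> suppTc U /pullback_continuous nbU.
by have [chi [chic Uchi]] := suppTc _ nbU; exists (pullback chi).
Qed.

Lemma Ditkin_image : Ditkin C -> Ditkin D.
Proof.
move=> ditC phi d phid; have [c Tc] := surjT d.
have /ditC : I_at (pullback phi) c by rewrite -Tc in phid.
move=> clc U /nbhs_rnorm[e e0 eU].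
have [|_ [[b Jb <-] cb]] := clc [set x | rnorm (c - x) < e].
  by apply/nbhs_rnorm; exists e.
exists (d * T b); split.
  by exists (T b) => // /supp_pullback.
apply: eU; rewrite -Tc -TM; apply: le_lt_trans cb.
rewrite -(zmod_morphism_linear linT); exact: T_le.
Qed.
End DitkinImage.

(** * Extension of contractive homomorphisms *)

(** The bound involves only the limit points [u] and [v]; [d <= 1] serves to replace the norm of
    [v'] by that of [v] plus 1. *)
Lemma rnorm_mul_dist (R : realType) (D : comBanachAlg R[i]) (u v u' v' : D) (d : R) :
  rnorm (u - u') < d -> rnorm (v - v') < d -> d <= 1 ->
  rnorm (u * v - u' * v') <= d * (rnorm u + rnorm v + 1).
Proof.
move=> ud vd d1; have d0 := le_lt_trans (rnorm_ge0 _) ud.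
have -> : u * v - u' * v' = u * (v - v') + (u - u') * v' by ring.
have v'_le : rnorm v' <= rnorm v + 1.
  rewrite -[v'](subKr v); apply: le_trans (rnormD _ _) _.
  by rewrite rnormN lerD2l (le_trans (ltW vd)).
apply: le_trans (rnormD _ _) _.
apply: le_trans (lerD (rnormM _ _) (rnormM _ _)) _.
have := ler_wpM2l (rnorm_ge0 u) (ltW vd).
have := ler_pM (rnorm_ge0 _) (rnorm_ge0 _) (ltW ud) v'_le; lra.
Qed.

Section Extension.
Variables (R : realType) (S : lmodType R[i]) (mul : S -> S -> S).
Variables (C D : comBanachAlg R[i]) (iota : S -> C) (T0 : S -> D).
Hypotheses (lin_iota : linear iota) (lin_T0 : linear T0).
Hypotheses (iotaM : forall s t, iota (mul s t) = iota s * iota t).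
Hypotheses (T0M : forall s t, T0 (mul s t) = T0 s * T0 t).
Hypothesis T0_le : forall s, rnorm (T0 s) <= rnorm (iota s).
Hypothesis dense_iota : dense (range iota).

(** The closure in [C * D] of the set of pairs [(iota s, T0 s)]; it will be the graph of the
    extension. *)
Definition closure_graph (c : C) (x : D) : Prop :=
  forall e, 0 < e -> exists2 s, rnorm (c - iota s) < e & rnorm (x - T0 s) < e.

Lemma closure_graph_iota s : closure_graph (iota s) (T0 s).
Proof. by move=> e e0; exists s; rewrite subrr rnorm0. Qed.

Lemma closure_graph_le c x : closure_graph c x -> rnorm x <= rnorm c.
Proof.
move=> cx; apply/ler_addgt0Pr => e e0.
have [|s cs xs] := cx (e / 2); first by rewrite divr_gt0.
have := rnormD (x - T0 s) (T0 s); rewrite subrK.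
have := rnormD (iota s - c) c; rewrite subrK rnorm_dist.
have := T0_le s; lra.
Qed.

Lemma closure_graph_linear k c x c' x' :
  closure_graph c x -> closure_graph c' x' ->
  closure_graph (k *: c + c') (k *: x + x').
Proof.
move=> cx cx' e e0; set K := rnorm (k : R[i]^o).
have K1 : 0 < K + 1 by rewrite ltr_wpDl ?rnorm_ge0.
(* Errors of this size add up to [K * d + d = e] with [d = e / (K + 1)]. *)
have d0 : 0 < e / (K + 1) by rewrite divr_gt0.
have [s cs xs] := cx _ d0; have [s' cs' xs'] := cx' _ d0.
have bound (V : normedModType R[i]) (u v u' v' : V) :
    rnorm (u - v) < e / (K + 1) -> rnorm (u' - v') < e / (K + 1) ->
    rnorm (k *: u + u' - (k *: v + v')) < e.
  move=> uv uv'; rewrite opprD addrACA -scalerBr; apply: le_lt_trans (rnormD _ _) _.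
  have -> : e = K * (e / (K + 1)) + e / (K + 1) by field; rewrite gt_eqF.
  by rewrite rnormZ ler_ltD // ler_wpM2l ?rnorm_ge0 // ltW.
by exists (k *: s + s'); rewrite ?lin_iota ?lin_T0; exact: bound.
Qed.

Lemma closure_graph_mul c x c' x' :
  closure_graph c x -> closure_graph c' x' -> closure_graph (c * c') (x * x').
Proof.
move=> cx cx' e e0; pose K := rnorm c + rnorm c' + rnorm x + rnorm x' + 1.
have [c_ge0 c'_ge0] := (rnorm_ge0 c, rnorm_ge0 c').
have [x_ge0 x'_ge0] := (rnorm_ge0 x, rnorm_ge0 x').
have K0 : 0 < K + 1 by rewrite /K; lra.
(* [K] dominates the constants of [rnorm_mul_dist] in both [C] and [D], so one [d] serves both;
   using [K + 1] makes the final bound strict. *)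
pose d := Num.min 1 (e / (K + 1)).
have d0 : 0 < d by rewrite lt_min ltr01 divr_gt0.
have d1 : d <= 1 by rewrite /d ge_min lexx.
have dK : d * K < e.
  apply: (@lt_le_trans _ _ (d * (K + 1))); first by rewrite ltr_pM2l // ltrDl.
  by rewrite -ler_pdivlMr // /d ge_min lexx orbT.
have [s cs xs] := cx _ d0; have [s' cs' xs'] := cx' _ d0.
exists (mul s s'); rewrite ?iotaM ?T0M; apply: le_lt_trans dK.
  by apply: le_trans (rnorm_mul_dist cs cs' d1) _; rewrite ler_pM2l // /K; lra.
by apply: le_trans (rnorm_mul_dist xs xs' d1) _; rewrite ler_pM2l // /K; lra.
Qed.

(** Choose [s n] with [iota (s n)] within [1 / (n + 1)] of [c]. By contractivity the [T0 (s n)] are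
    Cauchy with rate [2 / (n + 1)], and [D] is complete. *)
Lemma closure_graph_ex c : exists x, closure_graph c x.
Proof.
have /choice[s cs] (n : nat) : exists s, rnorm (c - iota s) < n.+1%:R^-1.
  have c0 : ((ball c (n.+1%:R^-1)%:C)° : set C) !=set0.
    by exists c; apply: nbhsx_ballx; rewrite ltcR invr_gt0.
  have [y [cy [s _ sy]]] := dense_iota c0 (@open_interior _ _).
  by exists s; apply/ball_rnorm; rewrite sy; exact: interior_subset.
have small (e : R) : 0 < e -> exists n, 2 * n.+1%:R^-1 < e.
  move=> e0; have [N _ /(_ N (leqnn N)) Ne] :=
    near_infty_natSinv_lt (PosNum (divr_gt0 e0 (ltr0Sn R 1))).
  by exists N; move: Ne; rewrite /= ltr_pdivlMr // mulrC.
have [|m n mn|x xs] :=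
  @complete_rnorm _ (banach_space D) (T0 \o s) (fun n => 2 * n.+1%:R^-1).
- exact: small.
- rewrite /= -(zmod_morphism_linear lin_T0); apply: le_trans (T0_le _) _.
  rewrite (zmod_morphism_linear lin_iota).
  apply: (@le_trans _ _ (rnorm (iota (s n) - c) + rnorm (c - iota (s m)))).
    by have := rnormD (iota (s n) - c) (c - iota (s m)); rewrite addrA subrK.
  rewrite mulr_natl mulr2n; apply: lerD; last exact: ltW (cs m).
  rewrite rnorm_dist; apply: le_trans (ltW (cs n)) _.
  by rewrite lef_pV2 ?posrE // ler_nat.
exists x => e /small[n ne]; exists (s n); last exact: le_lt_trans (xs n) ne.
apply: lt_trans (cs n) (le_lt_trans _ ne).
by rewrite ler_peMl ?invr_ge0 // ler1n.
Qed.

Lemma extend_dense_contraction : exists T : C -> D,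
  [/\ linear T, {morph T : c c' / c * c'}, forall c, rnorm (T c) <= rnorm c
    & forall s, T (iota s) = T0 s].
Proof.
(* Two values over [c] differ by a value over [0], whose norm is at most 0. The algebraic identities
   for [T] then follow from uniqueness. *)
have graph_fun c x x' : closure_graph c x -> closure_graph c x' -> x = x'.
  move=> cx cx'; have /closure_graph_le := closure_graph_linear (-1) cx' cx.
  rewrite !scaleN1r !addNr rnorm0 => le0; apply/eqP; rewrite -subr_eq0 addrC.
  by apply/eqP/rnorm0_eq0/eqP; rewrite eq_le le0 rnorm_ge0.
have [T TP] := choice closure_graph_ex; exists T; split.
- by move=> k c c'; apply: graph_fun (TP _) _; exact: closure_graph_linear.
- by move=> c c'; apply: graph_fun (TP _) _; exact: closure_graph_mul.
- by move=> c; exact: closure_graph_le.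
- by move=> s; apply: graph_fun (TP _) _; exact: closure_graph_iota.
Qed.

End Extension.

(** * Slice maps *)

(* [w a b] is [psi b *: a] or [phi a *: b]; stating both slice maps in terms of
   [w] covers the two factors at once. *)
Section Slice.
Variables (R : realType) (A B C D : comBanachAlg R[i]).
Variable (w : A -> B -> D).
Hypothesis wM : forall a a' b b', w (a * a') (b * b') = w a b * w a' b'.
(** For [w a b = psi b *: a] the pair is [f] and [psi]: composing with [w] turns a contractive
    functional into a form seen by the injective norm. *)
Hypothesis w_dual : forall f, dual_ball D f -> exists g h,
  [/\ dual_ball A g, dual_ball B h & forall a b, f (w a b) = prod_form g h a b].
Hypothesis w_surj : forall d, exists a b, w a b = d.

Lemma dual_ball_injective_norm (t : tensor A B) g h :
  dual_ball A g -> dual_ball B h -> rnorm (t (prod_form g h)) <= injective_norm t.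
Proof.
move=> gA hB; apply: sup_upper_bound; last by exists g => //; exists h.
split; first by exists (rnorm (t (prod_form g h))); exists g => //; exists h.
have [s ->] := tensor_sumP t.
(* The supremum bounds its set only if that set is bounded; any representation of [t] supplies this
   bound. *)
exists (\sum_(p <- s) rnorm p.1 * rnorm p.2) => _ [g' gA' [h' hB' <-]].
apply: le_trans (rnorm_sum _ _) _; apply: ler_sum => p _.
rewrite [leLHS]rnormcM ler_pM ?rnorm_ge0 // -ler_rnorm; [exact: gA'|exact: hB'].
Qed.

Lemma dual_ball_separates (d d' : D) :
  (forall f, dual_ball D f -> f d = f d') -> d = d'.
Proof.
move=> fdd'; have [f [f_le f_norming]] := Hahn_Banach_norming (d - d').
apply/eqP; rewrite -subr_eq0; apply/eqP/rnorm0_eq0/eqP.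
rewrite eq_le rnorm_ge0 andbT; apply: le_trans f_norming _.
rewrite linearB fdd' ?subrr ?rnorm0 // => x; by rewrite ler_rnorm.
Qed.

Definition slice_sum (s : seq (A * B)) : D := \sum_(p <- s) w p.1 p.2.

Lemma dual_ball_slice_sum (f : {linear D -> R[i]^o}) s g h :
  (forall a b, f (w a b) = prod_form g h a b) ->
  f (slice_sum s) = eval_sum s (prod_form g h).
Proof.
by move=> fw; rewrite /slice_sum linear_sum; apply: eq_bigr => p _; exact: fw.
Qed.

(** Computed from an arbitrarily chosen representation of [t]; [slice_eval_sum] shows that the
    choice is immaterial. *)
Definition slice (t : tensor A B) : D := slice_sum (projT1 (cid (tensor_sumP t))).

Lemma dual_ball_slice (f : {linear D -> R[i]^o}) t g h :
  (forall a b, f (w a b) = prod_form g h a b) ->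
  f (slice t) = t (prod_form g h).
Proof.
by move=> fw; rewrite (dual_ball_slice_sum _ fw) /slice; case: cid => s /= ->.
Qed.

(** Each functional of the dual ball takes on either side the value of [t] at a product form, which
    depends on [t] alone, and these functionals separate points. *)
Lemma slice_eval_sum (t : tensor A B) s :
  t = eval_sum s :> (bilinear_form A B -> R[i]^o) -> slice t = slice_sum s.
Proof.
move=> ts; apply: dual_ball_separates => f /w_dual[g [h [_ _ fw]]].
by rewrite (dual_ball_slice _ fw) (dual_ball_slice_sum _ fw) ts.
Qed.

Lemma slice_linear : linear slice.
Proof.
move=> k t u; apply: dual_ball_separates => f /w_dual[g [h [_ _ fw]]].
by rewrite linearP !(dual_ball_slice _ fw).
Qed.

Lemma sliceM t u : slice (mul_tensor t u) = slice t * slice u.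
Proof.
have [s ts] := tensor_sumP t; have [s' us'] := tensor_sumP u.
rewrite (slice_eval_sum (mul_tensor_sum ts us')) (slice_eval_sum ts).
rewrite (slice_eval_sum us') /slice_sum big_allpairs_dep /= mulr_suml.
apply: eq_bigr => p _; rewrite mulr_sumr; apply: eq_bigr => q _; exact: wM.
Qed.

Lemma slice_le_injective_norm t : rnorm (slice t) <= injective_norm t.
Proof.
have [f [f_le f_norming]] := Hahn_Banach_norming (slice t).
have /w_dual[g [h [gA hB fw]]] : dual_ball D f by move=> x; rewrite ler_rnorm.
apply: le_trans f_norming _; rewrite (dual_ball_slice _ fw).
exact: dual_ball_injective_norm.
Qed.

Theorem Ditkin_slice : Tomiyama_product A B C -> Ditkin C -> Ditkin D.
Proof.
move=> [N [iota [tomN [lin_iota [_ iotaM] isom_iota dense_iota]]]].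
have slice_le t : rnorm (slice t) <= rnorm (iota t).
  apply: le_trans (slice_le_injective_norm t) _.
  by rewrite isom_iota; exact: Tomiyama_ge_injective tomN t.
have [T [linT TM T_le Tiota]] :=
  extend_dense_contraction lin_iota slice_linear iotaM sliceM slice_le dense_iota.
apply: (Ditkin_image linT TM T_le) => d; have [a [b <-]] := w_surj d.
(* Surjectivity is already attained on pure tensors. *)
exists (iota (pure_tensor a b)); rewrite Tiota.
by rewrite (@slice_eval_sum _ [:: (a, b)]) // /slice_sum big_seq1.
Qed.

End Slice.

(** * The slices onto the two factors *)

Lemma character_dual_ball (R : realType) (D : comBanachAlg R[i]) (phi : D -> R[i]^o)
  (phiP : characters D phi) : dual_ball D (character_linear phiP).
Proof.
by move=> x; rewrite character_linearE ler_rnorm; exact: character_le_rnorm.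
Qed.

Theorem corollary2p2 (R : realType) (A B C : comBanachAlg R[i])
    (ssA : semisimple A) (ssB : semisimple B)
    (tomC : Tomiyama_product A B C) (ssC : semisimple C)
    (ditkinC : Ditkin C) :
  Ditkin A /\ Ditkin B.
Proof.
have [phi phiP] := semisimple_character ssA.
have [psi psiP] := semisimple_character ssB.
split.
- apply: (@Ditkin_slice _ A B C A (fun a b => psi b *: a)) tomC ditkinC.
  + move=> a a' b b'; have [_ psiM _] := psiP.
    by rewrite psiM -scalerAl -scalerAr scalerA.
  + move=> f fA; exists f, (character_linear psiP).
    split => //; first exact: character_dual_ball.
    by move=> a b; rewrite linearZ /= /prod_form character_linearE mulrC.
  (* As [psi 1 = 1], the slice restricts to the identity on the copy of [A] formed by the tensors of
     [a] with [1]. *)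
  + by move=> a; exists a, 1; rewrite (character1 psiP) scale1r.
- apply: (@Ditkin_slice _ A B C B (fun a b => phi a *: b)) tomC ditkinC.
  + move=> a a' b b'; have [_ phiM _] := phiP.
    by rewrite phiM -scalerAl -scalerAr scalerA.
  + move=> f fB; exists (character_linear phiP), f.
    split => //; first exact: character_dual_ball.
    by move=> a b; rewrite linearZ /= /prod_form character_linearE.
  + by move=> b; exists 1, b; rewrite (character1 phiP) scale1r.
Qed.
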